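(* Let $X$ be a quandle. If there exists $n\in\mathbb{Z}_{\ge0}$ such that $D^n(\{X\})=D^{n+1}(\{X\})$, then $$X=\bigsqcup_{A\in D^n(\{X\})}A$$ is the maximal connected subquandle decomposition of $X$. In particular, if $X$ is a finite quandle, then there exists $n\in\mathbb{Z}_{\ge0}$ such that $X=\bigsqcup_{A\in D^n(\{X\})}A$ is the maximal connected subquandle decomposition of $X$.
   Context: A quandle is a non-empty set $X$ with a binary operation $*$ such that (i) $a*a=a$ for all $a$; (ii) for every $a\in X$ the map $S_a:X\to X$, $S_a(x)=x*a$, is a bijection; (iii) $(a*b)*c=(a*c)*(b*c)$ for all $a,b,c$. A subquandle is a non-empty subset that is itself a quandle under $*$. The inner automorphism group $\mathrm{Inn}(X)$ is the group of bijections of $X$ generated by $\{S_a\mid a\in X\}$. The orbits of $X$ under $\mathrm{Inn}(X)$ are called the connected components of $X$ (they are subquandles); $\mathrm{Orb}_X(a)$ denotes the one containing $a$. A quandle $X$ is connected if $\mathrm{Inn}(X)$ acts transitively on $X$. A connected subquandle of $X$ is a subquandle which is connected as a quandle in its own right. A connected subquandle $A$ of $X$ is a maximal connected subquandle of $X$ if the only connected subquandle of $X$ including $A$ is $A$ itself. $X=\bigsqcup_{i\in I}A_i$ is called the maximal connected subquandle decomposition of $X$ when each $A_i$ is a maximal connected subquandle of $X$ (every quandle has exactly one such decomposition). For a set $\mathcal{A}$ of subquandles of $X$, define $D(\mathcal{A}):=\bigcup_{A\in\mathcal{A}}\{\mathrm{Orb}_A(a)\mid a\in A\}$, where $\mathrm{Orb}_A(a)$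 is the orbit of $a$ under $\mathrm{Inn}(A)$, with $A$ regarded as a quandle. Put $D^0(\mathcal{A}):=\mathcal{A}$ and $D^{k+1}(\mathcal{A}):=D(D^k(\mathcal{A}))$ for $k\in\mathbb{Z}_{\ge0}$. *)

(* Defs.v *)
From HB Require Import structures.
From mathcomp Require Import all_boot.
From mathcomp Require Import boolp classical_sets functions cardinality.

Set Implicit Arguments.
Unset Strict Implicit.
Unset Printing Implicit Defensive.

Local Open Scope classical_set_scope.

Record quandle_axioms (X : Type) (op : X -> X -> X) : Prop := QuandleAxioms {
  quandle_inhabited : inhabited X;
  quandle_idem : forall a, op a a = a;
  quandle_bij : forall a, bijective (fun x => op x a);
  quandle_distr : forall a b c, op (op a b) c = op (op a c) (op b c) }.

HB.mixin Record isQuandle X := {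
  qop : X -> X -> X;
  qopP : quandle_axioms qop }.

#[short(type="quandleType")]
HB.structure Definition Quandle := {X of isQuandle X}.

Notation "x *q y" := (qop x y) (at level 40, left associativity).

Section SubQuandle.
Variable X : quandleType.

Definition restr_op (A : set X) (clA : forall a b, A a -> A b -> A (a *q b))
  (x y : A) : A :=
  exist _ (val x *q val y) (mem_set (clA _ _ (set_valP x) (set_valP y))).

Record subquandle := Subquandle {
  sq_set :> set X;
  sq_closed : forall a b, sq_set a -> sq_set b -> sq_set (a *q b);
  sq_axioms : quandle_axioms (restr_op sq_closed) }.

HB.instance Definition _ (A : subquandle) :=
  isQuandle.Build (set_type (sq_set A)) (sq_axioms A).

(* Hence equality of sets of subquandles is equality of the sets of their
   underlying subsets of X. *)
Lemma subquandle_inj (A B : subquandle) : A = B :> set X -> A = B.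
Proof.
case: A B => [A cA aA] [B cB aB] /= AB; case: _ / AB in cB aB *.
have cAB : cA = cB by exact: Prop_irrelevance.
by case: _ / cAB in aB *; congr Subquandle; exact: Prop_irrelevance.
Qed.

Lemma restr_axioms (A : set X) (clA : forall a b, A a -> A b -> A (a *q b)) :
  A !=set0 -> (forall a b, A a -> A b -> exists2 c, A c & c *q a = b) ->
  quandle_axioms (restr_op clA).
Proof.
move=> [a0 Aa0] sA; have [_ idm bij dst] := @qopP X; split.
- by constructor; exists a0; exact: mem_set.
- by move=> a; apply: val_inj; exact: idm.
- move=> a; rewrite -setTT_bijective; split => //.
    move=> x y _ _ /(congr1 val) /= xy; apply: val_inj.
    exact: (bij_inj (bij (val a))).
  move=> b _; have [c Ac cab] := sA _ _ (set_valP a) (set_valP b).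
  by exists (exist _ c (mem_set Ac)) => //; exact: val_inj.
- by move=> a b c; apply: val_inj; exact: dst.
Qed.

Lemma setT_closed (a b : X) : [set: X] a -> [set: X] b -> [set: X] (a *q b).
Proof. by []. Qed.

Lemma setT_axioms : quandle_axioms (restr_op setT_closed).
Proof.
have [[x0] _ bij _] := @qopP X; apply: restr_axioms => [|a b _ _].
  by exists x0.
by have [g _ gK] := bij a; exists (g b) => //; exact: gK.
Qed.

Definition full_subquandle : subquandle := Subquandle setT_axioms.

End SubQuandle.

(* Subgroups, under composition, of the group of all bijections of X. *)
Record bij_group (X : Type) (G : set (X -> X)) : Prop := BijGroup {
  bij_group_bij : forall f, G f -> bijective f;
  bij_group_id : G id;
  bij_group_comp : forall f g, G f -> G g -> G (f \o g);
  bij_group_inv : forall f g, G f -> cancel f g -> cancel g f -> G g }.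

Section Inn.
Variable X : quandleType.

(* The map S_a. *)
Definition rtrans (a : X) : X -> X := fun x => x *q a.

Definition Inn : set (X -> X) := smallest (@bij_group X) (range rtrans).

Definition Orb (a : X) : set X := [set f a | f in Inn].

Definition connected_quandle : Prop :=
  forall a b : X, exists2 f, Inn f & f a = b.

Lemma Inn_group : bij_group Inn.
Proof.
split.
- have bijG : bij_group [set f : X -> X | bijective f].
    split => //=; first by exists id.
    + by move=> f g bf bg; exact: bij_comp.
    + by move=> f g _ fK gK; exists f.
  move=> f; apply: smallest_sub bijG _ f => _ [a _ <-].
  by have [_ _ bij _] := @qopP X; exact: bij.
- by move=> G [gG _]; exact: bij_group_id.
- move=> f g If Ig G GP; have [gG _] := GP.
  by apply: (bij_group_comp gG); [exact: If | exact: Ig].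
- move=> f g If fK gK G GP; have [gG _] := GP.
  by apply: (bij_group_inv gG _ fK gK); exact: If.
Qed.

Lemma Inn_rtrans a : Inn (rtrans a).
Proof. by move=> G [_]; apply; exists a. Qed.

End Inn.
Arguments Inn : clear implicits.
Arguments connected_quandle : clear implicits.

Section SubOrbit.
Variables (X : quandleType) (A : subquandle X) (a : A).

(* The orbit of a under Inn(A), as a subset of X. *)
Definition orb_set : set X := [set val x | x in Orb a].

Lemma orb_closed (x y : X) : orb_set x -> orb_set y -> orb_set (x *q y).
Proof.
move=> [_ [f If <-] <-] [y' _ <-].
exists (f a *q y') => //; exists (rtrans y' \o f) => //.
exact: (bij_group_comp (Inn_group _) (Inn_rtrans y') If).
Qed.

Lemma orb_axioms : quandle_axioms (restr_op orb_closed).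
Proof.
have gI := Inn_group A; apply: restr_axioms.
  by exists (val a); exists a => //; exists id => //; exact: bij_group_id.
move=> _ _ [x _ <-] [_ [f If <-] <-].
have [g gK Kg] := bij_group_bij gI (Inn_rtrans x).
exists (val (g (f a))); last by rewrite -[in RHS](Kg (f a)).
exists (g (f a)) => //; exists (g \o f) => //.
by apply: (bij_group_comp gI _ If); exact: bij_group_inv (Inn_rtrans x) gK Kg.
Qed.

Definition orb_subquandle : subquandle X := Subquandle orb_axioms.

End SubOrbit.

Section Decomposition.
Variable X : quandleType.

Definition D (AA : set (subquandle X)) : set (subquandle X) :=
  \bigcup_(A in AA) range (@orb_subquandle X A).

Definition Dn (n : nat) (AA : set (subquandle X)) : set (subquandle X) :=
  iter n D AA.

Definition maximal_connected_subquandle (A : subquandle X) : Prop :=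
  connected_quandle A /\
  forall B : subquandle X, connected_quandle B -> A `<=` B -> B = A.

(* The members A i, for i in J, are pairwise disjoint for distinct indices; a set
   of subquandles is decomposed by taking J to be that set and A := id. *)
Definition maximal_connected_decomposition (I : Type) (J : set I)
    (A : I -> subquandle X) : Prop :=
  [/\ \bigcup_(i in J) A i = [set: X],
      trivIset J A &
      forall i, J i -> maximal_connected_subquandle (A i)].

End Decomposition.

(* Main.v *)
(** The sets [D^n {X}] are successively finer partitions of [X]. An inner
    automorphism of a subquandle [B] of [A] is the restriction of one of [A], so
    a connected [B] contained in a block [A] lies in a single orbit of [A]; hence
    every connected subquandle lies in a block of each partition. If
    [D^n {X} = D^(n+1) {X}], every block coincides with its own orbits, so the
    blocks are connected, and therefore maximal. If [X] is finite, the decreasing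
    sequence of the equivalence relations of these partitions stabilizes. *)
Require Import Defs.
From mathcomp Require Import all_boot finmap.
From mathcomp Require Import boolp classical_sets functions cardinality.

Set Implicit Arguments.
Unset Strict Implicit.
Unset Printing Implicit Defensive.

Local Open Scope classical_set_scope.

(** Take [n] at which the cardinality of [F n] is least: then [F n.+1] is a subset of [F n] with no
    fewer elements, so the two finite sets agree. *)
Lemma finite_nonincreasing_stable (T : choiceType) (F : nat -> set T) :
  finite_set (F 0) -> (forall n, F n.+1 `<=` F n) -> exists n, F n = F n.+1.
Proof.
move=> F0 decF.
have finF n : finite_set (F n).
  by elim: n => // n; apply: sub_finite_set; exact: decF.
pose card n := #|` fset_set (F n)|%fset.
have /ex_minnP[k /asboolP[n cardn] mink] : exists k, `[< exists n, card n = k >].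
  by exists (card 0); apply/asboolP; exists 0.
exists n; apply/seteqP; split; last exact: decF.
have sub : (fset_set (F n.+1) `<=` fset_set (F n))%fset.
  by rewrite -fset_set_sub//; exact: decF.
have := fsubset_leqif_cards sub; case=> _ /esym; rewrite eqn_leq.
have -> : (card n.+1 <= card n)%N by exact: fsubset_leq_card.
have -> : (card n <= card n.+1)%N.
  by rewrite cardn; apply: mink; apply/asboolP; exists n.+1.
move=> /eqP/(congr1 (fun A => [set` A])); rewrite !fset_setK// => -> //.
Qed.

Section Orbits.
Variable X : quandleType.
Implicit Types A B : subquandle X.

Lemma subquandle_nonempty A : A !=set0.
Proof. by have [[x] _ _ _] := sq_axioms A; exists (val x); exact: set_valP. Qed.

(** The bijections of [B] that extend to a member of [Inn A] form a group containing every
    translation of [B], so minimality of [Inn B] applies. Agreement is expressed through [val], as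
    [B] and [A] are distinct types. *)
Lemma Inn_extend B A (BA : B `<=` A) (f : B -> B) : Inn B f ->
  exists2 g, Inn A g &
    forall (x : B) (y : A), val x = val y -> val (f x) = val (g y).
Proof.
pose G := [set f : B -> B | bijective f /\ exists2 g, Inn A g &
  forall (x : B) (y : A), val x = val y -> val (f x) = val (g y)].
suff IG : Inn B `<=` G by move=> /IG[].
have IA := Inn_group A; apply: (@smallest_sub _ _ _ G); last first.
  move=> _ [b _ <-]; split; first exact: (bij_group_bij (Inn_group B) (Inn_rtrans b)).
  exists (rtrans (exist _ (val b) (mem_set (BA _ (set_valP b))) : A)).
    exact: Inn_rtrans.
  by move=> x y xy /=; rewrite /rtrans /= xy.
split.
- by move=> ? [].
- by split; [exists id | exists id => //; exact: (bij_group_id IA)].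
- move=> f1 f2 [bf1 [g1 I1 fg1]] [bf2 [g2 I2 fg2]]; split; first exact: bij_comp.
  exists (g1 \o g2); first exact: (bij_group_comp IA I1 I2).
  by move=> x y xy; apply: fg1; exact: fg2.
- move=> f1 f2 [bf1 [g1 I1 fg1]] fK Kf; split; first by exists f1.
  (* The inverse [g2] of [g1] extends [f2]: with [z] the point [f2 x] seen in [A], [g1 z = y]
     because [f1 (f2 x) = x], whence [g2 y = z]. *)
  have [g2 gK Kg] := bij_group_bij IA I1.
  exists g2; first exact: (bij_group_inv IA I1 gK Kg).
  move=> x y xy.
  pose z : A := exist _ (val (f2 x)) (mem_set (BA _ (set_valP (f2 x)))).
  suff -> : g2 y = z by [].
  rewrite -[RHS]gK; congr g2; apply: val_inj.
  by rewrite -xy -(fg1 (f2 x) z)// Kf.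
Qed.

Lemma connected_sub_orb B A (b : A) :
  connected_quandle B -> B `<=` A -> sq_set B (val b) -> B `<=` orb_set b.
Proof.
move=> cB BA Bb y By.
have [f If fb] := cB (exist _ (val b) (mem_set Bb)) (exist _ y (mem_set By)).
have [g Ig fg] := Inn_extend BA If.
exists (g b); first by exists g.
by rewrite -(fg (exist _ (val b) (mem_set Bb)) b)// fb.
Qed.

Lemma orb_set_sub A (a : A) : orb_set a `<=` A.
Proof. by move=> _ [x _ <-]; exact: set_valP. Qed.

Lemma orb_set_refl A (a : A) : orb_set a (val a).
Proof. by exists a => //; exists id => //; exact: (bij_group_id (Inn_group _)). Qed.

Lemma Orb_eq (Y : quandleType) (a b c : Y) : Orb a c -> Orb b c -> Orb a = Orb b.
Proof.
have IY := Inn_group Y.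
suff sub (a' b' : Y) : Orb a' c -> Orb b' c -> Orb a' `<=` Orb b'.
  by move=> ac bc; apply/seteqP; split; exact: sub.
move=> [f If fa] [g Ig gb] _ [h Ih <-].
(* Go from [b] to [c] by [g], back to [a] by the inverse [f'] of [f], then on by [h]. *)
have [f' fK Kf] := bij_group_bij IY If.
exists (h \o (f' \o g)); last by rewrite /= gb -fa fK.
apply: (bij_group_comp IY Ih); apply: (bij_group_comp IY _ Ig).
exact: (bij_group_inv IY If fK Kf).
Qed.

Lemma connected_orb_set A (a : A) : A `<=` orb_set a -> connected_quandle A.
Proof.
move=> Aa x y.
have Oa z : Orb a z.
  by have [z' Oz /val_inj <-] := Aa _ (set_valP z).
have Ox : Orb x x by exists id => //; exact: (bij_group_id (Inn_group _)).
by have := Oa y; rewrite (Orb_eq (Oa x) Ox) => -[f If <-]; exists f.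
Qed.

Local Notation P n := (Dn n [set full_subquandle X]).

(** Orbits that meet lie in blocks of the previous level that meet, hence in one and the same block,
    where two orbits with a common point coincide. *)
Lemma Dn_trivIset n : trivIset (P n) id.
Proof.
elim: n => [|n IHn]; first by move=> _ _ -> ->.
move=> _ _ [A PA [a _ <-]] [A' PA' [a' _ <-]] [x [ax a'x]].
have AA' : A = A'.
  by apply: IHn => //; exists x; split; [exact: orb_set_sub ax|exact: orb_set_sub a'x].
case: _ / AA' in a' a'x PA' *; apply: subquandle_inj => /=.
case: ax a'x => y ay <- [z a'z /val_inj zy]; rewrite zy in a'z.
by rewrite /orb_set (Orb_eq ay a'z).
Qed.

Lemma Dn_cover n x : exists2 A, P n A & sq_set A x.
Proof.
elim: n => [|n [A PA Ax]]; first by exists (full_subquandle X).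
exists (orb_subquandle (exist _ x (mem_set Ax) : A)).
  by exists A => //; exists (exist _ x (mem_set Ax)).
exact: orb_set_refl.
Qed.

Lemma connected_sub_Dn n B : connected_quandle B -> exists2 A, P n A & B `<=` A.
Proof.
move=> cB; elim: n => [|n [A PA BA]]; first by exists (full_subquandle X).
have [b Bb] := subquandle_nonempty B.
pose b' : A := exist _ b (mem_set (BA _ Bb)).
exists (orb_subquandle b'); last exact: connected_sub_orb.
by exists A => //; exists b'.
Qed.

Lemma Dn_stable_decomposition n :
  P n = P n.+1 -> maximal_connected_decomposition (P n) id.
Proof.
move=> stab; split; first 2 last.
- move=> A PA; split.
    have [x Ax] := subquandle_nonempty A.
    pose a : A := exist _ x (mem_set Ax).
    (* By stability the orbit of [a] is itself a member of [P n]; it meets [A] at [x], so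
       disjointness identifies the two. *)
    suff Aa : orb_subquandle a = A by apply: (@connected_orb_set _ a); rewrite -{1}Aa.
    apply: (@Dn_trivIset n) => //.
      by rewrite stab; exists A => //; exists a.
    by exists x; split => //; exact: (orb_set_refl a).
  (* A connected [B] containing [A] lies in a block [A'], which meets [A] and so equals it; this
     squeezes [B] onto [A]. *)
  move=> B cB AB; have [A' PA' BA'] := connected_sub_Dn n cB.
  have AA' : A = A'.
    apply: (@Dn_trivIset n) => //; have [x Ax] := subquandle_nonempty A.
    by exists x; split => //; apply: BA'; exact: AB.
  by apply: subquandle_inj; apply/seteqP; split => //; rewrite AA'.
- by rewrite -subTset => x _; have [A PA Ax] := Dn_cover n x; exists A.
- exact: Dn_trivIset.
Qed.

Lemma Dn_finite_stable : finite_set [set: X] -> exists n, P n = P n.+1.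
Proof.
move=> finX.
(* [R n] is the relation of lying in a common block, a subset of the finite set of pairs;
   [{classic X}] supplies the choice structure on points. *)
pose R n := [set xy : {classic X} * {classic X} |
  exists2 A : subquandle X, P n A & sq_set A xy.1 /\ sq_set A xy.2].
have R0 : finite_set (R 0).
  by apply: sub_finite_set (finite_setX finX finX) => xy _; split.
have [|n Rn] := finite_nonincreasing_stable R0.
  move=> n xy [_ [A PA [a _ <-]] [ax ay]].
  by exists A => //; split; [exact: orb_set_sub ax|exact: orb_set_sub ay].
exists n.
(* The relation determines the partition: the blocks through [a] at levels [m] and [k] are both the
   class of [a]. *)
have sub m k : R m = R k -> P m `<=` P k.
  move=> Rmk A PA; have [a Aa] := subquandle_nonempty A.
  have [B PB Ba] := Dn_cover k a.
  suff -> : A = B by [].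
  apply: subquandle_inj; apply/seteqP; split=> y.
    move=> Ay; have : R m (a, y) by exists A.
    rewrite Rmk => -[B' PB' [/= B'a B'y]].
    by rewrite (_ : B = B')//; apply: (@Dn_trivIset k) => //; exists a.
  move=> By; have : R k (a, y) by exists B.
  rewrite -Rmk => -[A' PA' [/= A'a A'y]].
  by rewrite (_ : A = A')//; apply: (@Dn_trivIset m) => //; exists a.
by apply/seteqP; split; apply: sub; rewrite Rn.
Qed.

End Orbits.

Theorem theorem3 (X : quandleType) :
  (forall n : nat,
     Dn n [set full_subquandle X] = Dn n.+1 [set full_subquandle X] ->
     maximal_connected_decomposition (Dn n [set full_subquandle X]) id) /\
  (finite_set [set: X] ->
   exists n : nat,
     maximal_connected_decomposition (Dn n [set full_subquandle X]) id).
Proof.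
split=> [n|/Dn_finite_stable[n stab]]; first exact: Dn_stable_decomposition.
by exists n; exact: Dn_stable_decomposition.
Qed.
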